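(* Let $M$ and $N$ be two semilattice models over the finite sets of constants $C_M$ and $C_N$ respectively. (i) $M\oplus N=F_{C_M\cup C_N}\big(Th_0^+(M)\cup Th_0^+(N)\big)$. (ii) Either $Th_0^+(M^{|C_N})\not\subseteq Th_0^+(N)$, or there is an embedding from $N$ into $M\oplus N$ with image $(M\oplus N)^{|C_N}=N$. (iii) Either there is a duple $r$ over $C_N$ such that $M\models r^+$ and $N\models r^-$, or there is an embedding from $N$ into $M\oplus N$ with image $(M\oplus N)^{|C_N}=N$. (iv) If $C_M\cap C_N=\emptyset$, there are embeddings from $M$ and from $N$ into $M\oplus N$.
   Context: A semilattice is a nonempty set with a commutative, associative, idempotent operation $\odot$, ordered by $a\le b$ iff $a\odot b=b$. For a finite set $C$ of constants, $F_C(\emptyset)$ is the free semilattice on $C$; its elements are called terms over $C$. A model over $C$ is a semilattice $M$ with a map $C\to M$ whose image generates $M$; it induces the natural homomorphism $\nu_M:F_C(\emptyset)\to M$. A duple over $C$ is an ordered pair $r=(r_L,r_R)$ of terms over $C$; $M\models r^+$ means $\nu_M(r_L)\le\nu_M(r_R)$, and $M\models r^-$ means $\nu_M(r_L)\not\le\nu_M(r_R)$ (both presuppose that the terms of $r$ only use constants of $M$, so in (iii) $r$ is over $C_M\cap C_N$). $Th_0^+(M)$ is the set of positive duples satisfied by $M$. Models over the same constants are regarded as equal if they satisfy the same positive duples; e.g. $(M\oplus N)^{|C_N}=N$ is equality of models over $C_N$. $M^{|Q}$ is the subalgebra of $M$ generated by the constants of $M$ lying in $Q$, viewed as a model over those constants;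 thus $M^{|C_N}$ is generated by $C_M\cap C_N$ (if $C_M\cap C_N=\emptyset$ it is empty and $Th_0^+(M^{|C_N})=\emptyset$). $F_C(R^+)$ is the freest model over $C$ of a set $R^+$ of positive duples: it satisfies $R^+$, and every positive duple it satisfies is satisfied by every model over $C$ of $R^+$. Join model: if $C_M\cap C_N=\emptyset$, $M\oplus N$ is the freest model over $C_M\cup C_N$ (the one satisfying the fewest positive duples) such that the maps $M\to M\oplus N$ and $N\to M\oplus N$ sending each constant to the constant of the same name are well-defined injective homomorphisms. If $C_M\cap C_N=\{c_1,\dots,c_h\}\ne\emptyset$, let $N'$ be $N$ with each $c_i$ renamed to a new constant $c'_i$; then $M\oplus N$ is the quotient $(M\oplus N')/\theta$, where $\theta$ is the smallest congruence identifying $c_i$ with $c'_i$ for all $i$, viewed as a model over $C_M\cup C_N$ (each $c'_i$ being renamed back to $c_i$). *)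

(* Defs.v *)
From HB Require Import structures.
From mathcomp Require Import all_boot all_order finmap.
From mathcomp Require Import boolp classical_sets.

Set Implicit Arguments.
Unset Strict Implicit.
Unset Printing Implicit Defensive.

#[local] Set Warnings "-redundant-canonical-projection".

Import Order.TTheory.
Local Open Scope classical_set_scope.
Local Open Scope order_scope.

(** Semilattices are MathComp's [joinSemilatticeType]s: the operation is the
    join [`|`], and [x <= y] iff [x `|` y = y].  The carrier is allowed to be
    empty, so that the subalgebra generated by no constant is again one; the
    nonemptiness of a model is to be assumed separately.  Models are finitely
    generated, hence finite, so the choice structure on the carrier is no
    restriction. *)

Section Subalgebra.
Context {d : Order.disp_t} {L : joinSemilatticeType d}.

Definition join_closed (A : set L) : Prop :=
  forall x y, A x -> A y -> A (x `|` y).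

Definition gen (G : set L) : set L := smallest join_closed G.

Lemma gen_sub (G : set L) : G `<=` gen G.
Proof. by move=> x Gx A [_]; apply. Qed.

Lemma gen_join (G : set L) : join_closed (gen G).
Proof.
by move=> x y gx gy A [cA GA]; apply: (cA); [apply: gx|apply: gy]; split.
Qed.

Lemma gen_ind (G A : set L) : join_closed A -> G `<=` A -> gen G `<=` A.
Proof. by move=> cA GA x; apply; split. Qed.

Record subalg (G : set L) : Type :=
  Subalg { subalg_val : L; subalgP : subalg_val \in gen G }.

Variable G : set L.

HB.instance Definition _ := [isSub for @subalg_val G].
HB.instance Definition _ := [Choice of subalg G by <:].
HB.instance Definition _ := [SubChoice_isSubPOrder of subalg G by <: with d].

Definition subalg_join (x y : subalg G) : subalg G :=
  Subalg (mem_set (gen_join (set_mem (subalgP x)) (set_mem (subalgP y)))).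

Lemma subalg_joinP (x y z : subalg G) :
  (subalg_join x y <= z) = (x <= z) && (y <= z).
Proof. by rewrite -!Order.le_val /= leUx. Qed.

HB.instance Definition _ :=
  @Order.POrder_isJoinSemilattice.Build d (subalg G) subalg_join subalg_joinP.
End Subalgebra.

(** The free semilattice on a finite set [C]: the nonempty subsets of [C]
    under union, [c] being represented by [finset.set1 c].  [nu_join], [nu_gen] and
    [nu_unique] below give its universal property. *)
Section Terms.
Variable C : finType.

Record term := Term { supp :> {set C}; supp_neq0 : supp != finset.set0 }.

HB.instance Definition _ := [isSub for supp].
HB.instance Definition _ := [Choice of term by <:].

Fact term_display : Order.disp_t. Proof. exact: (Order.Disp tt tt). Qed.

Definition term_le (s t : term) : bool := supp s \subset supp t.

Fact term_le_refl : reflexive term_le. Proof. by move=> s; exact: subxx. Qed.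
Fact term_le_anti : antisymmetric term_le.
Proof. by move=> s t st; apply/val_inj/eqP; rewrite finset.eqEsubset. Qed.
Fact term_le_trans : transitive term_le.
Proof. by move=> t s u; exact: fintype.subset_trans. Qed.

HB.instance Definition _ := Order.Le_isPOrder.Build term_display term
  term_le_refl term_le_anti term_le_trans.

Fact setU_neq0 (s t : term) : supp s :|: supp t != finset.set0.
Proof. by rewrite finset.setU_eq0 negb_and supp_neq0. Qed.

Definition term_join (s t : term) : term := Term (setU_neq0 s t).

Fact term_joinP (s t u : term) :
  (term_join s t <= u) = (s <= u) && (t <= u).
Proof. exact: finset.subUset. Qed.

HB.instance Definition _ :=
  @Order.POrder_isJoinSemilattice.Build term_display term term_join term_joinP.

Fact set1_neq0 (c : C) : finset.set1 c != finset.set0.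
Proof. by apply/finset.set0Pn; exists c; rewrite inE. Qed.

Definition term1 (c : C) : term := Term (set1_neq0 c).

Definition duple : Type := (term * term)%type.
End Terms.

Section TermMap.
Variables (C D : finType) (i : C -> D).

Fact imset_neq0 (t : term C) : i @: supp t != finset.set0.
Proof. by rewrite imset_eq0 supp_neq0. Qed.

Definition term_map (t : term C) : term D := Term (imset_neq0 t).

Definition duple_map (r : duple C) : duple D := (term_map r.1, term_map r.2).
End TermMap.

(** Models over an arbitrary finite set [C] of constants. *)
Record model (C : finType) := Model {
  disp : Order.disp_t;
  carrier :> joinSemilatticeType disp;
  cst : C -> carrier;
  cst_gen : gen (range cst) = setT }.

Section Models.
Variable C : finType.
Implicit Types (M N : model C) (t : term C) (r : duple C).

Definition term_pt t : C := xchoose (finset.set0Pn _ (supp_neq0 t)).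

(** The join of the [cst c], [c] in [t]; as there is no bottom element, the
    big join starts from the constant [term_pt t] of [t] itself. *)
Definition nu M t : M := \big[Order.join/cst M (term_pt t)]_(c in supp t) cst M c.

Definition sat M r : bool := nu M r.1 <= nu M r.2.
Definition nsat M r : bool := ~~ (nu M r.1 <= nu M r.2).

Definition Th M : set (duple C) := [set r | sat M r].

(** Equality of models over the same constants. *)
Definition model_eq M N : Prop := Th M = Th N.

(** [F] is F_C(R+), the freest model over [C] of [R]; it is determined up to
    [model_eq]. *)
Definition is_freest (R : set (duple C)) (F : model C) : Prop :=
  R `<=` Th F /\ forall M, R `<=` Th M -> Th F `<=` Th M.

Lemma nu_le M t (x : M) :
  (nu M t <= x) <-> (forall c, c \in supp t -> cst M c <= x).
Proof.
have ptP : term_pt t \in supp t by exact: (xchooseP (finset.set0Pn _ (supp_neq0 t))).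
rewrite /nu; split=> [h c ct | h]; last first.
  by elim/big_ind: _ => [|y z yx zx|c]; [exact: h | rewrite leUx yx | exact: h].
apply: le_trans h; rewrite -big_enum /=.
have: c \in enum (supp t) by rewrite mem_enum.
elim: (enum _) => //= a s IH; rewrite inE big_cons => /orP[/eqP ->|/IH].
  exact: leUl.
by move/le_trans; apply; exact: leUr.
Qed.

Lemma nu_join M : {morph nu M : s t / s `|` t}.
Proof.
move=> s t; apply/le_anti/andP; split.
  apply/nu_le => c; rewrite inE => /orP[] h.
    by apply: le_trans (leUl _ _); move: c h; apply/nu_le.
  by apply: le_trans (leUr _ _); move: c h; apply/nu_le.
rewrite leUx; apply/andP; split; apply/nu_le => c h;
  by apply: (iffLR (nu_le _ _) (lexx _)); rewrite inE h ?orbT.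
Qed.

Lemma nu_gen M c : nu M (term1 c) = cst M c.
Proof.
apply/le_anti/andP; split; first by apply/nu_le => a; rewrite inE => /eqP ->.
by apply: (iffLR (nu_le _ _) (lexx _)); rewrite inE.
Qed.

Lemma nu_unique M (f : term C -> M) :
  {morph f : s t / s `|` t} -> (forall c, f (term1 c) = cst M c) -> f =1 nu M.
Proof.
move=> fU f1 t.
have [n] := ubnP #|supp t|; elim: n t => // n IH t /ltnSE tn.
have [c ct] := finset.set0Pn _ (supp_neq0 t).
have [t0|tD0] := eqVneq (supp t :\ c) finset.set0.
  have -> : t = term1 c.
    by apply: val_inj; rewrite /= -(finset.setD1K ct) t0 finset.setU0.
  by rewrite f1 nu_gen.
have -> : t = term1 c `|` Term tD0 by apply: val_inj; rewrite /= finset.setD1K.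
rewrite fU f1 IH ?nu_join ?nu_gen //=.
by apply: leq_trans tn; rewrite [X in (_ < X)%N](cardsD1 c) ct.
Qed.
End Models.

Section NameMaps.
Variables (A C : finType) (i : A -> C).

(** A homomorphism of models sending each constant [a] to the constant named
    [i a]. *)
Definition model_hom (M : model A) (J : model C) (f : M -> J) : Prop :=
  {morph f : x y / x `|` y} /\ forall a, f (cst M a) = cst J (i a).

Definition model_embedding (M : model A) (J : model C) (f : M -> J) : Prop :=
  model_hom f /\ injective f.
End NameMaps.

Section Restriction.
Context {K : choiceType} {Q C : {fset K}}.
Variables (sQC : (Q `<=` C)%fset) (M : model C).

(** The carrier of M^{|Q}, as a subset of [M]. *)
Definition restr_set : set M := gen (range (cst M \o fincl sQC)).

Definition restr_cst (q : Q) :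
    subalg (range (cst M \o fincl sQC)) :=
  Subalg (mem_set (gen_sub (ex_intro2 _ _ q I erefl))).

Lemma restr_gen : gen (range restr_cst) = setT.
Proof.
apply/seteqP; split=> // -[x xP] _.
pose B (y : M) := exists yP : y \in _, gen (range restr_cst) (Subalg yP).
suff: B x by case=> xP'; rewrite (bool_irrelevance xP' xP).
apply: (gen_ind _ _ (set_mem xP)) => [y z [yP hy] [zP hz]|_ [q _ <-]].
  by eexists; exact: (gen_join hy hz).
by eexists; apply: gen_sub; exists q.
Qed.

(** M^{|Q} for a set [Q] of constants of [M]. *)
Definition restr : model Q := Model restr_gen.
End Restriction.
Arguments restr_set {K Q C} sQC M.

Definition joint_embeddings (A B C : finType) (i : A -> C) (j : B -> C)
    (M : model A) (N : model B) (J : model C) : Prop :=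
  (exists f : M -> J, model_embedding i f) /\
  (exists g : N -> J, model_embedding j g).

(** [J] is the freest model over [C] such that the maps [M -> J] and [N -> J]
    sending each constant to the constant named by [i], resp. [j], are
    well-defined injective homomorphisms. *)
Definition is_disjoint_join (A B C : finType) (i : A -> C) (j : B -> C)
    (M : model A) (N : model B) (J : model C) : Prop :=
  joint_embeddings i j M N J /\
  forall J' : model C, joint_embeddings i j M N J' -> Th J `<=` Th J'.

Section Congruence.
Context {d : Order.disp_t} {L : joinSemilatticeType d}.

Definition congruence (E : set (L * L)) : Prop :=
  [/\ forall x, E (x, x),
      forall x y, E (x, y) -> E (y, x),
      forall x y z, E (x, y) -> E (y, z) -> E (x, z) &
      forall x x' y y', E (x, x') -> E (y, y') -> E (x `|` y, x' `|` y')].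
End Congruence.

Section Join.
Context {K : choiceType} {CM CN : {fset K}}.

(** The constants of M (+) N' when the [c] in [CM `&` CN] are renamed in [N]:
    [inl c] is the constant [c], and [inr c] is the new constant c'. *)
Definition primed : finType :=
  ((CM `|` CN)%fset + (CM `&` CN)%fset)%type.

Definition nameM (c : CM) : primed := inl (fincl (fsubsetUl CM CN) c).

Definition nameN' (c : CN) : primed :=
  if insub (val c) is Some c' then inr c'
  else inl (fincl (fsubsetUr CM CN) c).

Definition fsubIU : (CM `&` CN `<=` CM `|` CN)%fset :=
  fsubset_trans (fsubsetIl CM CN) (fsubsetUl CM CN).

Definition unprime (c : primed) : (CM `|` CN)%fset :=
  match c with inl c => c | inr c => fincl fsubIU c end.

(** [q] exhibits [J] as the quotient of [D] by the smallest congruence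
    identifying each c with c'. *)
Definition is_unpriming_quotient (D : model primed)
    (J : model (CM `|` CN)%fset) (q : D -> J) : Prop :=
  [/\ model_hom unprime q,
      forall z, exists x, q x = z &
      forall x y, q x = q y <->
        smallest congruence
          [set (cst D (inl (fincl fsubIU c)), cst D (inr c)) | c in setT]
          (x, y)].

(** [J] is M (+) N; it is determined up to [model_eq]. *)
Definition is_join (M : model CM) (N : model CN)
    (J : model (CM `|` CN)%fset) : Prop :=
  if (CM `&` CN)%fset == fset0 then
    is_disjoint_join (fincl (fsubsetUl CM CN)) (fincl (fsubsetUr CM CN)) M N J
  else
    exists2 D : model primed, is_disjoint_join nameM nameN' M N D &
      exists q : D -> J, is_unpriming_quotient q.

(** The embedding of [N] into M (+) N asserted with image
    (M (+) N)^{|CN} = N. *)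
Definition embeds_as_restriction (N : model CN)
    (J : model (CM `|` CN)%fset) : Prop :=
  (exists f : N -> J, model_embedding (fincl (fsubsetUr CM CN)) f /\
                      range f = restr_set (fsubsetUr CM CN) J) /\
  model_eq (restr (fsubsetUr CM CN) J) N.
End Join.

(* Main.v *)
(** Homomorphisms from a model over [C] to the semilattice {0 < 1} correspond to
    the sets [U] of constants (those sent to 0) that respect the theory of the
    model, and they separate its points.  So the freest model of [R] satisfies
    exactly the duples respected by every [U] respecting [R], and entailment can
    be checked one [U] at a time.  A set over the joint constants respects both
    theories iff its traces on [CM] and [CN] do, and (ii) amounts to extending
    each set respecting [Th N] to the constants of [M]. *)
Require Import Defs.
From mathcomp Require Import all_boot all_order finmap.
From mathcomp Require Import boolp classical_sets.

Set Implicit Arguments.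
Unset Strict Implicit.
Unset Printing Implicit Defensive.

Import Order.TTheory Order.DefaultSetSubsetOrder.
Local Open Scope classical_set_scope.
Local Open Scope order_scope.

(** * Entailment of duples, tested on sets of constants *)

Section Consequence.
Variable C : finType.
Implicit Types (R : set (duple C)) (U : {set C}) (M : model C).

(** The homomorphism to {0 < 1} given by [U] sends a term to 0 exactly when its support lies in [U];
    the condition says that it preserves every duple of [R]. *)
Definition respects R U : Prop :=
  forall r, R r -> supp r.2 \subset U -> supp r.1 \subset U.

Definition consequence R : set (duple C) :=
  [set r | forall U, respects R U -> supp r.2 \subset U -> supp r.1 \subset U].

Lemma sub_consequence R : R `<=` consequence R.
Proof. by move=> r Rr U; exact. Qed.

Lemma respects_consequence R U : respects (consequence R) U <-> respects R U.
Proof.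
split=> h r; first by move=> /sub_consequence; exact: h.
by apply.
Qed.

Lemma respectsU R R' U :
  respects (R `|` R') U <-> respects R U /\ respects R' U.
Proof.
split=> [h|[h h'] r [/h//|/h'//]].
by split=> r Rr; apply: h; [left|right].
Qed.

Lemma consequence_eq R R' :
  (forall U, respects R U <-> respects R' U) -> consequence R = consequence R'.
Proof. by move=> h; apply/seteqP; split=> r cr U /h; exact: cr. Qed.

(** The [U] of the homomorphism sending exactly the elements below [x] to 0. These homomorphisms
    separate the points of [M]. *)
Definition below M (x : M) : {set C} := finset (fun c => cst M c <= x).

Lemma sub_below M (x : M) (t : term C) :
  (supp t \subset below x) = (nu M t <= x).
Proof.
apply/fintype.subsetP/idP => [h|/nu_le h c ct].
  by apply/nu_le => c /h; rewrite inE.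
by rewrite inE; exact: h.
Qed.

Lemma respects_below M (x : M) : respects (Th M) (below x).
Proof. by move=> r rM; rewrite !sub_below; exact: le_trans. Qed.

(** Soundness: for [U] the constants below the right-hand side of [r], the premise is reflexivity
    and the conclusion is the truth of [r] in [M]. *)
Lemma consequence_Th M R : R `<=` Th M -> consequence R `<=` Th M.
Proof.
move=> RM r /(_ (below (nu M r.2))); rewrite !sub_below; apply=> //.
by move=> s /RM; exact: respects_below.
Qed.

Lemma nu_surj M (x : M) : exists t, nu M t = x.
Proof.
suff: gen (range (cst M)) `<=` [set x | exists t, nu M t = x].
  by rewrite cst_gen; exact.
apply: gen_ind => [_ _ [s <-] [t <-]|_ [c _ <-]].
  by exists (s `|` t); rewrite nu_join.
by exists (term1 c); rewrite nu_gen.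
Qed.
End Consequence.

(** * The model generated by a family in a semilattice *)

Section GeneratedModel.
Context {d : Order.disp_t} {L : joinSemilatticeType d} {C : finType}.
Variable f : C -> L.

Definition generated_cst (c : C) : subalg (range f) :=
  Subalg (mem_set (gen_sub (ex_intro2 _ _ c I erefl))).

Lemma generated_gen : gen (range generated_cst) = setT.
Proof.
apply/seteqP; split=> // -[x xP] _.
(* Quantifying over the membership proof makes [B] a predicate on [L], as induction on [gen]
   requires. *)
pose B y := exists yP : y \in gen (range f),
  gen (range generated_cst) (Subalg yP).
suff: B x by case=> xP'; rewrite (bool_irrelevance xP' xP).
apply: (gen_ind (A := B) _ _ (set_mem xP)) => [y z [yP hy] [zP hz]|_ [c _ <-]].
  by eexists; exact: (gen_join hy hz).
by eexists; apply: gen_sub; exists c.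
Qed.

Definition generated : model C := Model generated_gen.
End GeneratedModel.

(** * Homomorphisms and embeddings read off from theories *)

Section Homomorphisms.
Variable C : finType.
Implicit Types (M : model C) (t : term C).

Lemma morph_nu_le M d (L : joinSemilatticeType d) (g : M -> L) t (y : L) :
    {morph g : u v / u `|` v} ->
  g (nu M t) <= y <-> (forall c, c \in supp t -> g (cst M c) <= y).
Proof.
move=> gU; split=> [h c ct|h].
  apply: le_trans h; have /nu_le/(_ c ct)/join_r <- := lexx (nu M t).
  by rewrite gU leUl.
rewrite /nu; elim/big_ind: _ => [|u v uy vy|//].
  by apply: h; exact: (xchooseP (finset.set0Pn _ (supp_neq0 t))).
by rewrite gU leUx uy.
Qed.

Variables (D : finType) (i : C -> D).

Lemma subset_term_map t (U : {set D}) :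
  (supp (term_map i t) \subset U) = (supp t \subset i @^-1: U).
Proof. by rewrite /= sub_imset_pre. Qed.

Lemma respects_map (R : set (duple C)) (U : {set D}) :
  respects (duple_map i @` R) U <-> respects R (i @^-1: U).
Proof.
split=> h r; last by case=> s Rs <-; rewrite !subset_term_map; exact: h.
by move=> Rr; rewrite -!subset_term_map; apply: (h (duple_map i r)); exists r.
Qed.

Lemma term_mapU : {morph term_map i : s t / s `|` t}.
Proof. by move=> s t; apply: val_inj; exact: imsetU. Qed.

Lemma model_hom_nu M (J : model D) (f : M -> J) t :
  model_hom i f -> f (nu M t) = nu J (term_map i t).
Proof.
case=> fU fc; apply/le_anti/andP; split.
  apply/(morph_nu_le _ _ fU) => c ct; rewrite fc.
  by have /nu_le := lexx (nu J (term_map i t)); apply; exact: imset_f.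
apply/nu_le => _ /imsetP[c ct ->]; rewrite -fc.
exact: (iffLR (morph_nu_le _ _ fU) (lexx _)).
Qed.

Lemma model_hom_sat M (J : model D) (f : M -> J) r :
  model_hom i f -> sat M r -> sat J (duple_map i r).
Proof.
move=> fH; rewrite /sat -!(model_hom_nu _ fH) => /join_r <-.
by case: fH => -> _; exact: leUl.
Qed.

Lemma model_embedding_sat M (J : model D) (f : M -> J) r :
  model_embedding i f -> sat J (duple_map i r) = sat M r.
Proof.
move=> [fH fI]; apply/idP/idP; last exact: model_hom_sat fH.
rewrite /sat -!(model_hom_nu _ fH) => /join_r.
by case: fH => <- _ /fI <-; exact: leUl.
Qed.

(** Each element is represented by a chosen term, which is then evaluated in [J]. The choice is
    immaterial because an equality in [M] amounts to two duples of [Th M]. *)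
Lemma model_hom_exists M (J : model D) :
  duple_map i @` Th M `<=` Th J -> exists f : M -> J, model_hom i f.
Proof.
move=> MJ; have [tm tmK] := choice (@nu_surj _ M).
have nu_map s t : nu M s = nu M t -> nu J (term_map i s) = nu J (term_map i t).
  move=> st; apply/le_anti/andP; split.
    by apply: (MJ (duple_map i (s, t))); exists (s, t) => //; rewrite /Th/= /sat/= st.
  by apply: (MJ (duple_map i (t, s))); exists (t, s) => //; rewrite /Th/= /sat/= st.
exists (fun x => nu J (term_map i (tm x))); split=> [x y|c].
  by rewrite -nu_join -term_mapU; apply: nu_map; rewrite nu_join !tmK.
rewrite -nu_gen (nu_map _ (term1 c)) ?tmK ?nu_gen //.
by rewrite -nu_gen; congr nu; apply: val_inj; exact: imset_set1.
Qed.

Lemma model_embedding_exists M (J : model D) :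
  (forall r, sat J (duple_map i r) = sat M r) ->
  exists f : M -> J, model_embedding i f.
Proof.
move=> MJ; have [|f fH] := @model_hom_exists M J.
  by move=> _ [r rM <-]; rewrite /Th/= MJ.
exists f; split=> // x y; have [[s <-] [t <-]] := (nu_surj x, nu_surj y).
rewrite !(model_hom_nu _ fH) => st; apply/le_anti/andP.
by split; [have := MJ (s, t)|have := MJ (t, s)];
  rewrite /sat/= st lexx => <-.
Qed.

Lemma range_model_hom M (J : model D) (f : M -> J) :
  model_hom i f -> range f = gen (range (cst J \o i)).
Proof.
move=> [fU fc]; apply/seteqP; split.
  suff: gen (range (cst M)) `<=` [set x | gen (range (cst J \o i)) (f x)].
    by rewrite cst_gen => h _ [x _ <-]; exact: h.
  apply: gen_ind => [x y gx gy|_ [c _ <-]] /=.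
    by rewrite fU; exact: gen_join.
  by rewrite fc; apply: gen_sub; exists c.
apply: gen_ind => [_ _ [x _ <-] [y _ <-]|_ [c _ <-]].
  by exists (x `|` y).
by exists (cst M c).
Qed.
End Homomorphisms.

(** * Construction of the freest model *)

Section FreestModel.
Variable C : finType.
Implicit Types (R : set (duple C)) (M : model C).

(* The constant [c] is the set of those [U] that respect [R] and omit [c];
   such [U] are the kernels of the homomorphisms to the semilattice {0 < 1}. *)
Definition freest_cst R (c : C) : {set {set C}} :=
  finset (fun U => `[< respects R U >] && (c \notin U)).

Definition freest R : model C := generated (freest_cst R).

Lemma val_nu_freest R (t : term C) :
  subalg_val (nu (freest R) t) =
    finset (fun U => `[< respects R U >] && ~~ (supp t \subset U)).
Proof.
have vU : {morph (fun x : freest R => subalg_val x) : x y / x `|` y} by [].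
apply/le_anti/andP; split.
  apply/(morph_nu_le _ _ vU) => c ct; apply/fintype.subsetP => U; rewrite !inE.
  case/andP=> -> cU; apply: contra cU => /fintype.subsetP; exact.
apply/fintype.subsetP => U; rewrite inE => /andP[RU /fintype.subsetPn[c ct cU]].
have /(morph_nu_le _ _ vU)/(_ c ct)/fintype.subsetP :=
  lexx (subalg_val (nu (freest R) t)).
by apply; rewrite inE RU.
Qed.

(** Inclusion between the values of two terms, as families of sets [U] not containing the support,
    is the contrapositive of entailment. *)
Lemma Th_freest R : Th (freest R) = consequence R.
Proof.
apply/seteqP; split=> r.
  rewrite /Th/= /sat -Order.le_val /= !val_nu_freest => /fintype.subsetP h U RU.
  apply: contraLR => rU; have := h U; rewrite !inE rU asboolT //.
  by move=> /(_ isT).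
move=> Rr; rewrite /Th/= /sat -Order.le_val /= !val_nu_freest.
apply/fintype.subsetP => U; rewrite !inE => /andP[/[dup]/asboolP RU ->] /=.
by apply: contra; exact: Rr.
Qed.

Lemma is_freestP R M : is_freest R M <-> Th M = consequence R.
Proof.
split=> [[RM Mmin]|ME].
  apply/seteqP; split; last exact: consequence_Th.
  by rewrite -Th_freest; apply: Mmin; rewrite Th_freest; exact: sub_consequence.
by split=> [|N RN]; rewrite ME; [exact: sub_consequence|exact: consequence_Th].
Qed.
End FreestModel.

(** * The join over disjoint constants *)

Section DisjointJoin.
Variables (A B C : finType) (i : A -> C) (j : B -> C).
Variables (M : model A) (N : model B).
Hypotheses (i_inj : injective i) (ij_disj : forall a b, i a != j b).

Definition join_axioms : set (duple C) :=
  (duple_map i @` Th M) `|` (duple_map j @` Th N).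

(* A set respecting [Th M] extends by all the constants outside [i]. *)
Lemma disjoint_join_sat (J : model C) (r : duple A) :
  Th J = consequence join_axioms -> sat J (duple_map i r) = sat M r.
Proof.
move=> JE; apply/idP/idP => [rJ|rM]; last first.
  have : consequence join_axioms (duple_map i r).
    by apply: sub_consequence; left; exists r.
  by rewrite -JE.
have {rJ} : consequence join_axioms (duple_map i r) by rewrite -JE.
set U := below (nu M r.2); pose V := ~: (i @: ~: U).
have iV : i @^-1: V = U.
  by apply/setP => a; rewrite !inE mem_imset // !inE negbK.
have jV : j @^-1: V = [set: B]%SET.
  apply/setP => b; rewrite !inE; apply/imsetP => -[a _ /esym/eqP].
  by apply/negP.
move=> /(_ V); rewrite !subset_term_map iV !sub_below; apply=> //.
apply/respectsU; split; apply/respects_map; first by rewrite iV; exact: respects_below.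
by rewrite jV => s _ _; exact: finset.subsetT.
Qed.
End DisjointJoin.

(** Joint embeddings force the axioms. Conversely, by [disjoint_join_sat] the axioms entail nothing
    new on either side, so a model of exactly their consequences embeds both. *)
Lemma is_disjoint_joinP (A B C : finType) (i : A -> C) (j : B -> C)
    (M : model A) (N : model B) (J : model C) :
  injective i -> injective j -> (forall a b, i a != j b) ->
  is_disjoint_join i j M N J <-> Th J = consequence (join_axioms i j M N).
Proof.
move=> i_inj j_inj ij.
have joint J' : Th J' = consequence (join_axioms i j M N) ->
    joint_embeddings i j M N J'.
  move=> J'E; split; apply: model_embedding_exists => r.
    exact: disjoint_join_sat J'E.
  apply: (@disjoint_join_sat _ _ _ j i N M) => // [a b|]; first by rewrite eq_sym.
  by rewrite [join_axioms _ _ _ _]setUC.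
have axioms J' : joint_embeddings i j M N J' -> join_axioms i j M N `<=` Th J'.
  by case=> -[f fE] [g gE] _ [] [r rM <-]; rewrite /Th/=
    ?(model_embedding_sat _ fE) ?(model_embedding_sat _ gE).
split=> [[/axioms JR Jmin]|JE].
  apply/seteqP; split; last exact: consequence_Th.
  by rewrite -Th_freest; apply/Jmin/joint; exact: Th_freest.
split; first exact: joint.
by move=> J' /axioms; rewrite JE; exact: consequence_Th.
Qed.

(** * Identification of the shared constants with their primed copies *)

Section Unpriming.
Context {K : choiceType} {CM CN : {fset K}}.
Local Notation P := (@primed K CM CN).
Local Notation C := (CM `|` CN)%fset.
Local Notation u := (@unprime K CM CN).
Implicit Types (D : model P) (J : model C).

Lemma unprime_nameN' (c : CN) : u (nameN' c) = fincl (fsubsetUr CM CN) c.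
Proof.
by rewrite /nameN'; case: insubP => [c' _ c'E|_] //; apply: val_inj.
Qed.

Lemma nameM_inj : injective (@nameM K CM CN).
Proof. by move=> a b /(congr1 u) /(congr1 val) /= ab; exact: val_inj. Qed.

Lemma nameN'_inj : injective (@nameN' K CM CN).
Proof.
move=> a b /(congr1 u); rewrite !unprime_nameN' => /(congr1 val) /= ab.
exact: val_inj.
Qed.

Lemma nameM_neq_nameN' (a : CM) (b : CN) : nameM a != nameN' b.
Proof.
rewrite /nameN'; case: insubP => // bI; apply: contra bI => /eqP/(congr1 u).
by move=> /(congr1 val)/= ab; rewrite in_fsetI -{1}ab !fsvalP.
Qed.

Lemma term_map_unprime_inl (t : term C) : term_map u (term_map inl t) = t.
Proof. by apply: val_inj; rewrite /= -imset_comp imset_id. Qed.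

Definition unpriming_pairs D : set (D * D) :=
  [set (cst D (inl (fincl fsubIU c)), cst D (inr c)) | c in setT].
Arguments unpriming_pairs : clear implicits.

Lemma hom_congruence D J (f : D -> J) :
  model_hom u f ->
  smallest congruence (unpriming_pairs D) `<=` [set xy | f xy.1 = f xy.2].
Proof.
move=> [fU fc] xy; apply; split; first split=> //=.
- by move=> x y z -> ->.
- by move=> x x' y y' fx fy; rewrite !fU fx fy.
- by move=> _ [c _ <-] /=; rewrite !fc.
Qed.

(** Any homomorphism from [D] compatible with [u] identifies each c with c', so it identifies
    whatever [q] does. Duples over [C] are lifted to [D] along [inl]. *)
Lemma unpriming_quotient_freest D J (q : D -> J) :
  is_unpriming_quotient q -> is_freest (duple_map u @` Th D) J.
Proof.
case=> qH _ qE; split=> [_ [r rD <-]|J' J'D r]; first exact: model_hom_sat qH _.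
have [f fH] := model_hom_exists J'D.
rewrite /Th/= /sat -(term_map_unprime_inl r.1) -(term_map_unprime_inl r.2).
rewrite -!(model_hom_nu _ qH) -!(model_hom_nu _ fH).
move=> /join_r; case: (qH) => <- _ /qE/(hom_congruence fH)/= <-.
by case: fH => -> _; exact: leUl.
Qed.

(* For a congruence [E] identifying each c with c', the constants lying below
   [y] modulo [E] form a set that respects [Th D]. *)
Lemma freest_unpriming_kernel D J (q : D -> J) (E : set (D * D)) :
  Th J = consequence (duple_map u @` Th D) -> model_hom u q ->
  congruence E -> unpriming_pairs D `<=` E ->
  forall x y, q x = q y -> E (x, y).
Proof.
move=> JE qH [Er Es Et Ej] EP.
(* The relation says that [v] lies below [y] modulo [E]; it is inherited by smaller elements. *)
have Edown v w y : v <= w -> E (w `|` y, y) -> E (v `|` y, y).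
  move=> vw wy; apply: (Et _ _ _ _ wy).
  have /Es/(Ej _ _ _ _ (Er v)) := wy.
  by rewrite joinA (join_r vw) => h; exact: Et h (Er _).
have Ecst p : E (cst D p, cst D (inl (u p))).
  by case: p => c; [exact: Er|apply/Es/EP; exists c].
pose U y : {set C} := finset (fun c => `[< E (cst D (inl c) `|` y, y) >]).
have UE y t : supp t \subset u @^-1: U y <-> E (nu D t `|` y, y).
  split=> [/fintype.subsetP h|h].
    have Uc c : c \in supp t -> E (cst D c `|` y, y).
      move=> /h; rewrite !inE; exact: (Et _ _ _ (Ej _ _ _ _ (Ecst c) (Er y))).
    rewrite /nu; elim/big_ind: _ => [|v w vE wE|//].
      by apply: Uc; exact: (xchooseP (finset.set0Pn _ (supp_neq0 t))).
    by rewrite -joinA; exact: (Et _ _ _ (Ej _ _ _ _ (Er v) wE) vE).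
  apply/fintype.subsetP => c ct; rewrite !inE.
  apply: (Et _ (cst D c `|` y)); first exact: Ej (Es _ _ (Ecst c)) (Er _).
  by apply: (Edown _ _ _ _ h); have /nu_le := lexx (nu D t); apply.
have UD y : respects (duple_map u @` Th D) (U y).
  by apply/respects_map => r rD /UE h; apply/UE; exact: Edown h.
have Ele x y : q x <= q y -> E (x `|` y, y).
  have [[s <-] [t <-]] := (nu_surj x, nu_surj y).
  rewrite !(model_hom_nu _ qH) => st.
  have : Th J (term_map u s, term_map u t) by [].
  rewrite JE => /(_ _ (UD (nu D t))); rewrite !subset_term_map => h.
  by apply/UE/h/UE; rewrite joinxx; exact: Er.
move=> x y qxy; apply: (Et _ (x `|` y)); last by apply: Ele; rewrite qxy.
by apply: Es; rewrite joinC; apply: Ele; rewrite qxy.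
Qed.

Lemma unpriming_quotient_exists D J :
  Th J = consequence (duple_map u @` Th D) ->
  exists q : D -> J, is_unpriming_quotient q.
Proof.
move=> JE; have [|q qH] := @model_hom_exists _ _ u D J.
  by rewrite JE; exact: sub_consequence.
exists q; split=> // [z|x y].
  have [t <-] := nu_surj z; exists (nu D (term_map inl t)).
  by rewrite (model_hom_nu _ qH) term_map_unprime_inl.
split; last exact: hom_congruence qH _.
by move=> qxy E [Ec EP]; exact: (freest_unpriming_kernel JE qH Ec EP).
Qed.

(** Priming and then unpriming is the plain inclusion of constants, so each [U] has the same traces
    on [CM] and [CN] on both sides. *)
Lemma consequence_unprime (M : model CM) (N : model CN) :
  consequence
    (duple_map u @` consequence (join_axioms (@nameM K CM CN) nameN' M N)) =
  consequence
    (join_axioms (fincl (fsubsetUl CM CN)) (fincl (fsubsetUr CM CN)) M N).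
Proof.
apply: consequence_eq => U; rewrite respects_map respects_consequence !respectsU.
rewrite !respects_map.
have -> : nameM @^-1: (u @^-1: U) = fincl (fsubsetUl CM CN) @^-1: U.
  by apply/setP => c; rewrite !inE.
have -> // : nameN' @^-1: (u @^-1: U) = fincl (fsubsetUr CM CN) @^-1: U.
by apply/setP => c; rewrite !inE unprime_nameN'.
Qed.

(** Both cases of the definition lead to one theory, through which alone the join is handled from
    here on, except in the disjoint case of the theorem. *)
Lemma is_joinP (M : model CM) (N : model CN) J :
  is_join M N J <->
  Th J = consequence
    (join_axioms (fincl (fsubsetUl CM CN)) (fincl (fsubsetUr CM CN)) M N).
Proof.
rewrite /is_join; case: eqP => [I0|_].
  apply: is_disjoint_joinP => [a b /(congr1 val) ab|a b /(congr1 val) ab|a b].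
  - exact: val_inj.
  - exact: val_inj.
  apply/eqP => /(congr1 val)/= ab; have := in_fset0 (val a).
  by rewrite -I0 in_fsetI fsvalP [val a]ab fsvalP.
have DP D := is_disjoint_joinP M N D nameM_inj nameN'_inj nameM_neq_nameN'.
split=> [[D /DP DE [q /unpriming_quotient_freest/is_freestP]]|JE].
  by rewrite DE consequence_unprime.
exists (freest (join_axioms (@nameM K CM CN) nameN' M N)).
  by apply/DP; exact: Th_freest.
by apply: unpriming_quotient_exists; rewrite Th_freest consequence_unprime.
Qed.
End Unpriming.

(** * Restriction to a set of constants *)

Section Restriction.
Context {K : choiceType} {Q C : {fset K}} (sQC : (Q `<=` C)%fset).
Variable M : model C.

Lemma restr_embedding :
  model_embedding (fincl sQC) (fun x : restr sQC M => subalg_val x).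
Proof. by split; [split|exact: val_inj]. Qed.

Lemma sat_restr r : sat (restr sQC M) r = sat M (duple_map (fincl sQC) r).
Proof. by rewrite (model_embedding_sat _ restr_embedding). Qed.
End Restriction.

(** * Embedding of [N] into the join *)

Section Embedding.
Context {K : choiceType} {CM CN : {fset K}}.
Variables (M : model CM) (N : model CN).
Local Notation iM := (fincl (fsubsetUl CM CN)).
Local Notation iN := (fincl (fsubsetUr CM CN)).
Local Notation jM := (fincl (fsubsetIl CM CN)).
Local Notation jN := (fincl (fsubsetIr CM CN)).

Hypothesis MN : duple_map jN @` Th (restr (fsubsetIl CM CN) M) `<=` Th N.

(* [V] consists of the constants of [M] below the join of the shared constants
   of [U]; without a bottom element, the case of no shared constant is separate. *)
Lemma respects_extend (U : {set CN}) : respects (Th N) U ->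
  exists2 V : {set CM}, respects (Th M) V & jM @^-1: V = jN @^-1: U.
Proof.
move=> UN; set W := jN @^-1: U.
have [W0|W0] := eqVneq W finset.set0.
  exists finset.set0; last by rewrite W0; apply/setP => c; rewrite !inE.
  (* Supports are nonempty, so the empty set respects every theory. *)
  by move=> r _; rewrite finset.subset0 (negPf (supp_neq0 _)).
pose t := Term W0; exists (below (nu M (term_map jM t))).
  exact: respects_below.
apply/setP => c; apply/idP/idP => [|cW]; last first.
  rewrite 2!inE; have /nu_le := lexx (nu M (term_map jM t)); apply.
  exact: imset_f.
rewrite 2!inE -nu_gen => ct.
(* A shared constant below the join of [W] in [M] is also below it in [N] by [MN], so it lies in
   [U]. *)
have /UN : Th N (duple_map jN (term1 c, t)).
  apply: MN; exists (term1 c, t) => //; rewrite /Th/= sat_restr /sat/=.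
  rewrite (_ : term_map jM _ = term1 (jM c)) //.
  by apply: val_inj; exact: imset_set1.
by rewrite !subset_term_map /= => /(_ (subxx _)); rewrite finset.sub1set.
Qed.

(** A duple false in [N] is refuted by some [U] respecting [Th N]; extending [U] to the joint
    constants refutes it in [J]. *)
Lemma join_sat_r (J : model (CM `|` CN)%fset) (r : duple CN) :
  is_join M N J -> sat J (duple_map iN r) = sat N r.
Proof.
move=> /is_joinP JE; apply/idP/idP => [rJ|rN]; last first.
  have : consequence (join_axioms iM iN M N) (duple_map iN r).
    by apply: sub_consequence; right; exists r.
  by rewrite -JE.
have {rJ} : consequence (join_axioms iM iN M N) (duple_map iN r) by rewrite -JE.
set U := below (nu N r.2).
have UN : respects (Th N) U by exact: respects_below.
have [V VM VU] := respects_extend UN.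
have VUE (a : CM) (b : CN) : val a = val b -> (a \in V) = (b \in U).
  move=> ab; have cI : val a \in (CM `&` CN)%fset by rewrite in_fsetI {2}ab !fsvalP.
  have -> : a = jM [` cI]%fset by exact: val_inj.
  have -> : b = jN [` cI]%fset by exact: val_inj.
  by have /setP/(_ [` cI]%fset) := VU; rewrite ![_ \in _ @^-1: _]inE.
(* As [V] and [U] agree on the shared constants, their union has exactly these two traces. *)
pose W := (iM @: V) :|: (iN @: U).
have iMW : iM @^-1: W = V.
  apply/setP => a; rewrite inE finset.in_setU; apply/orP/idP => [[]/imsetP[b bV]|aV].
  - by move=> /(congr1 val) ab; have -> : a = b by exact: val_inj.
  - by move=> /(congr1 val) ab; rewrite (VUE _ _ ab).
  - by left; exact: imset_f.
have iNW : iN @^-1: W = U.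
  apply/setP => a; rewrite inE finset.in_setU; apply/orP/idP => [[]/imsetP[b bV]|aV].
  - by move=> /(congr1 val) ab; rewrite -(VUE _ _ (esym ab)).
  - by move=> /(congr1 val) ab; have -> : a = b by exact: val_inj.
  - by right; exact: imset_f.
move=> /(_ W); rewrite !subset_term_map iNW !sub_below; apply=> //.
by apply/respectsU; split; apply/respects_map; rewrite ?iMW ?iNW.
Qed.

Lemma join_embeds_as_restriction (J : model (CM `|` CN)%fset) :
  is_join M N J -> embeds_as_restriction N J.
Proof.
move=> MNJ; have JN r := join_sat_r r MNJ; split.
  have [f fE] := model_embedding_exists JN; exists f; split=> //.
  exact: range_model_hom fE.1.
by apply/seteqP; split=> r; rewrite /Th/= sat_restr JN.
Qed.
End Embedding.

Theorem theorem32 (K : choiceType) (CM CN : {fset K})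
    (M : model CM) (N : model CN) (M_inh : inhabited M) (N_inh : inhabited N) :
  (exists J, is_join M N J) /\
  forall J : model (CM `|` CN)%fset, is_join M N J ->
  [/\ (* (i) *)
      exists2 F : model (CM `|` CN)%fset,
        is_freest
          ((duple_map (fincl (fsubsetUl CM CN)) @` Th M) `|`
           (duple_map (fincl (fsubsetUr CM CN)) @` Th N))%classic F
        & model_eq J F,
      (* (ii) *)
      ~ (duple_map (fincl (fsubsetIr CM CN)) @` Th (restr (fsubsetIl CM CN) M)
          `<=` Th N)%classic
      \/ embeds_as_restriction N J,
      (* (iii) *)
      (exists r : duple (CM `&` CN)%fset,
         sat M (duple_map (fincl (fsubsetIl CM CN)) r) /\
         nsat N (duple_map (fincl (fsubsetIr CM CN)) r))
      \/ embeds_as_restriction N J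
    & (* (iv) *)
      (CM `&` CN = fset0)%fset ->
      (exists f : M -> J, model_embedding (fincl (fsubsetUl CM CN)) f) /\
      (exists g : N -> J, model_embedding (fincl (fsubsetUr CM CN)) g)].
Proof.
split=> [|J MNJ].
  exists (freest
    (join_axioms (fincl (fsubsetUl CM CN)) (fincl (fsubsetUr CM CN)) M N)).
  by apply/is_joinP/Th_freest.
split.
- by exists J => //; apply/is_freestP; exact/is_joinP.
- have [MN|] := pselect (duple_map (fincl (fsubsetIr CM CN)) @`
    Th (restr (fsubsetIl CM CN) M) `<=` Th N); last by left.
  by right; exact: join_embeds_as_restriction MNJ.
- have [|MN] := pselect (exists r : duple (CM `&` CN)%fset,
    sat M (duple_map (fincl (fsubsetIl CM CN)) r) /\
    nsat N (duple_map (fincl (fsubsetIr CM CN)) r)); first by left.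
  (* Without a separating duple, the inclusion of theories in (ii) holds. *)
  right; apply: join_embeds_as_restriction MNJ => _ [r rM <-].
  have [//|rN] := boolP (sat N (duple_map (fincl (fsubsetIr CM CN)) r)).
  by case: MN; exists r; rewrite -sat_restr.
- by move=> I0; move: MNJ; rewrite /is_join I0 eqxx => -[].
Qed.
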